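(* Let $a,u$ be coprime positive integers with $a\neq u$. Then the polynomial $P_{a,u}(t)$ does not factor in $\mathbb{Z}[t]$ as a product of two monic polynomials of degree $4$.
   Context: For positive integers $a,u$, put $\Delta=u^{2}-a^{2}$ and define the even monic polynomial $$P_{a,u}(t)=t^{8}+6\Delta\,t^{6}+(\Delta^{2}-2a^{2}u^{2})\,t^{4}-6\Delta\,a^{2}u^{2}\,t^{2}+a^{4}u^{4}\in\mathbb{Z}[t].$$ *)

(* Defs.v *)
From mathcomp Require Import all_boot all_order all_algebra.

Set Implicit Arguments.
Unset Strict Implicit.
Unset Printing Implicit Defensive.

Import GRing.Theory.

Local Open Scope ring_scope.

(* The subtraction is the one of int, not the truncated one of nat. *)
Definition Delta (a u : nat) : int := u%:Z ^+ 2 - a%:Z ^+ 2.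

Definition P (a u : nat) : {poly int} :=
  'X^8
  + (6 * Delta a u) *: 'X^6
  + (Delta a u ^+ 2 - 2 * a%:Z ^+ 2 * u%:Z ^+ 2) *: 'X^4
  - (6 * Delta a u * a%:Z ^+ 2 * u%:Z ^+ 2) *: 'X^2
  + (a%:Z ^+ 4 * u%:Z ^+ 4)%:P.

(* Main.v *)
Require Import Defs.
From mathcomp Require Import all_boot all_order all_algebra zify ring.

(** Write D = u^2 - a^2, n = a u and s = t^2.  Everything rests on
      P = (s^2 + 3 D s - n^2)^2 - 8 D^2 s^2,
    which splits P over Q(sqrt 2).

    Suppose P = Q R with Q = A + t B and R = C + t E, where A, B, C, E are
    polynomials in s.  As P is even, A E + B C = 0, and B, E have degree at most
    one in s.  Hence one of three things happens ([no_quartic_factors]).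
    - P vanishes at the rational root of B; the formula above then makes 2 a
      rational square.
    - C = A and E = - B, so that P = A^2 - s B^2 ([no_mirror_factors]).
      Comparing coefficients, either - 128 (n D)^2 is a square, which is absurd,
      or B = E = 0.
    - B = E = 0 ([no_even_factors]).  The middle coefficients of A and C are
      3 D - m and 3 D + m, and eliminating the constant terms gives
        (m^2 - 9 D^2) (m^2 - 8 D^2) = (2 n m)^2.

    So the theorem comes down to (d^2 - 9 e^2) (d^2 - 8 e^2) = j^2, where d / e is
    m / D in lowest terms.  The two factors are coprime and hence squares up to a
    common sign; the negative sign is impossible modulo 8, and the positive one
    gives squares
      g^2 + e^2 = f^2,   g^2 + 9 e^2 = d^2.
    That g^2 + e^2 and g^2 + 9 e^2 are never squares together for coprime
    g, e > 0 ([no_concordant]) is proved by infinite descent on g e.  If 3 divides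
    g, then (e, g / 3) is a smaller solution.  Otherwise the Pythagorean triples
    (g, e, f) and (g, 3 e, d) are primitive, with even legs 2 p q and 2 r s, say,
    and p q is r s or r s / 3.  A common refinement of the two factorizations,
    with factors x, y, z, w, turns the relation between the odd legs
    p^2 - q^2 and r^2 - s^2 into an equation y^2 M = z^2 N between quadratic forms
    M, N in x and w.  For g even it is impossible modulo a power of 2; for e even it
    says that x and w form a smaller solution. *)

Import GRing.Theory Num.Theory.

Local Open Scope nat_scope.

(** * Coprimality and squares *)

(** [gcdn m k ^ 2] is the gcd of [m * m], [m * k] and [k * k = m * n], that is,
    [m] times the gcd of [m], [k] and [n], which is 1. *)
Lemma coprime_mul_sqr (m n k : nat) : coprime m n -> m * n = k ^ 2 ->
  m = gcdn m k ^ 2.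
Proof.
move=> co_mn mnk.
rewrite -[in RHS]mulnn muln_gcdr !muln_gcdl !mulnn -mnk [k * m]mulnC.
rewrite -!mulnn -!muln_gcdr -gcdnA [X in gcdn m X]gcdnA gcdnn gcdnCA.
by rewrite (eqP co_mn) gcdn1 muln1.
Qed.

Lemma coprime_mul_sqrP (m n k : nat) : coprime m n -> m * n = k ^ 2 ->
  exists x y, m = x ^ 2 /\ n = y ^ 2.
Proof.
move=> co_mn mnk; exists (gcdn m k), (gcdn n k).
split; first exact: coprime_mul_sqr mnk.
by apply: (@coprime_mul_sqr n m k); rewrite 1?coprime_sym // mulnC.
Qed.

(** Common refinement of two factorizations of the same number, with [x] the gcd
    of [p] and [r].  Then [y] and [z] are coprime as the cofactors of this gcd,
    [x] and [w] as divisors of [p] and [q]. *)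
Lemma four_number (p q r s : nat) :
    0 < p -> 0 < q -> 0 < r -> coprime p q -> p * q = r * s ->
  exists x y z w,
    [/\ [/\ p = x * y, q = z * w, r = x * z & s = y * w],
        [/\ 0 < x, 0 < y, 0 < z & 0 < w], coprime y z & coprime x w].
Proof.
move=> p_gt0 q_gt0 r_gt0 co_pq pq_rs; set x := gcdn p r.
have x_gt0 : 0 < x by rewrite gcdn_gt0 p_gt0.
have [y Ep] : exists y, p = x * y.
  by have /dvdnP[y ->] := dvdn_gcdl p r; exists y; rewrite mulnC.
have [z Er] : exists z, r = x * z.
  by have /dvdnP[z ->] := dvdn_gcdr p r; exists z; rewrite mulnC.
have y_gt0 : 0 < y by move: p_gt0; rewrite Ep muln_gt0 => /andP[].
have z_gt0 : 0 < z by move: r_gt0; rewrite Er muln_gt0 => /andP[].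
have co_yz : coprime y z.
  by rewrite /coprime -(eqn_pmul2l x_gt0) muln_gcdr -Ep -Er muln1.
have yq_zs : y * q = z * s.
  by apply/eqP; rewrite -(eqn_pmul2l x_gt0) !mulnA -Ep -Er pq_rs.
have /dvdnP[w Eq] : z %| q.
  by rewrite -(@Gauss_dvdr _ y) 1?coprime_sym // yq_zs dvdn_mulr.
have w_gt0 : 0 < w by move: q_gt0; rewrite Eq muln_gt0 => /andP[].
exists x, y, z, w; split=> //; last first.
  by move: co_pq; rewrite Ep Eq coprimeMl !coprimeMr => /andP[/andP[->]].
split=> //; first by rewrite Eq mulnC.
by apply/eqP; rewrite -(eqn_pmul2l z_gt0) -yq_zs Eq; apply/eqP; ring.
Qed.

Lemma odd_addb_factors (x y z w : nat) :
  odd (x * y) (+) odd (z * w) -> ~~ [&& odd x, odd y, odd z & odd w].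
Proof.
by rewrite !oddM; case: (odd x); case: (odd y); case: (odd z); case: (odd w).
Qed.

Lemma proportional_sqr (y z m n : nat) : 0 < z -> coprime y z ->
  y ^ 2 * m = z ^ 2 * n -> exists k, m = k * z ^ 2 /\ n = k * y ^ 2.
Proof.
move=> z_gt0 co_yz ym_zn.
have /dvdnP[k Em] : z ^ 2 %| m.
  rewrite -(@Gauss_dvdr _ (y ^ 2)); first by rewrite ym_zn dvdn_mulr ?dvdnn.
  by rewrite coprimeXl // coprimeXr // coprime_sym.
exists k; split=> //; apply/eqP.
have z2_gt0 : 0 < z ^ 2 by rewrite expn_gt0 z_gt0.
by rewrite -(eqn_pmul2l z2_gt0) -ym_zn Em; apply/eqP; ring.
Qed.

(** Applies to a common divisor [k] of two forms [a * x ^ 2 + b * w ^ 2] of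
    determinant 8 or -8. *)
Lemma dvdn_8 (k x w : nat) : coprime x w ->
  k %| 8 * x ^ 2 -> k %| 8 * w ^ 2 -> k \in [:: 1; 2; 4; 8].
Proof.
move=> co_xw kx kw.
have : k %| gcdn (8 * x ^ 2) (8 * w ^ 2) by rewrite dvdn_gcd kx.
rewrite -muln_gcdr (eqP (_ : coprime (x ^ 2) (w ^ 2))) ?coprimeXl ?coprimeXr //.
rewrite muln1 => k8; have := dvdn_leq (isT : 0 < 8) k8.
by move: k8; clear kx kw; do 9 (case: k => [|k] //).
Qed.

Lemma not_both_even (x w : nat) : coprime x w -> odd x || odd w.
Proof.
move=> co_xw; apply/norP=> -[]; rewrite -!dvdn2 => x2 w2.
by have := dvdn_gcd 2 x w; rewrite x2 w2 (eqP co_xw).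
Qed.

(** The form in which congruences modulo small powers of 2 are passed to linear
    arithmetic below. *)
Lemma sqr_mod8 (x : nat) :
  (if odd x then exists i, x ^ 2 = 8 * i + 1 else exists i, x ^ 2 = 4 * i ^ 2).
Proof.
rewrite -(odd_double_half x); set h := x./2; rewrite oddD odd_double addbF.
case: (odd x) => /=; last by exists h; rewrite -muln2; ring.
have /dvdnP[i hi] : 2 %| h * h.+1 by rewrite dvdn2 oddM /=; case: (odd h).
exists i; have -> : (1 + h.*2) ^ 2 = 4 * (h * h.+1) + 1 by rewrite -muln2; ring.
rewrite hi; ring.
Qed.

(** * The forms g^2 + e^2 and g^2 + 9 e^2 *)

(** The factor [k] common to both forms divides 8.  It is not 4 or 8, since [x] and
    [w] are not both even; if it were 2, all four numbers would be odd. *)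
Lemma common_factor_1_9 (x y z w : nat) :
    0 < z -> coprime x w -> coprime y z -> ~~ [&& odd x, odd y, odd z & odd w] ->
    y ^ 2 * (x ^ 2 + w ^ 2) = z ^ 2 * (9 * x ^ 2 + w ^ 2) ->
  x ^ 2 + w ^ 2 = z ^ 2 /\ 9 * x ^ 2 + w ^ 2 = y ^ 2.
Proof.
move=> z_gt0 co_xw co_yz not_odd.
case/(proportional_sqr _ _ _ _ z_gt0 co_yz) => k [Ez Ey].
have : k \in [:: 1; 2; 4; 8].
  apply: (dvdn_8 _ _ _ co_xw); apply/dvdnP.
    by exists (y ^ 2 - z ^ 2); rewrite mulnBl ![_ * k]mulnC -Ez -Ey; lia.
  exists (9 * z ^ 2 - y ^ 2).
  by rewrite mulnBl -mulnA ![_ * k]mulnC -Ez -Ey; lia.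
have := not_both_even _ _ co_xw; move: not_odd.
rewrite !inE => N O /or4P[] /eqP Ek; move: Ez Ey; rewrite Ek; try lia;
have := sqr_mod8 x; have := sqr_mod8 w; have := sqr_mod8 y; have := sqr_mod8 z;
move: N O;
case: (odd x); case: (odd y); case: (odd z); case: (odd w) => //= _ _
  [i1 ?] [i2 ?] [i3 ?] [i4 ?]; lia.
Qed.

(** Here too the common factor [k] divides 8.  If [k] is 1, 2 or 8, then [y] and
    [z], or [x] and [w], are both even; if [k] is 4, all four numbers are odd. *)
Lemma common_factor_3_1 (x y z w : nat) :
    0 < z -> coprime x w -> coprime y z -> ~~ [&& odd x, odd y, odd z & odd w] ->
    y ^ 2 * (3 * x ^ 2 + w ^ 2) = z ^ 2 * (x ^ 2 + 3 * w ^ 2) -> False.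
Proof.
move=> z_gt0 co_xw co_yz not_odd.
case/(proportional_sqr _ _ _ _ z_gt0 co_yz) => k [Ez Ey].
have : k \in [:: 1; 2; 4; 8].
  apply: (dvdn_8 _ _ _ co_xw); apply/dvdnP.
    exists (3 * z ^ 2 - y ^ 2).
    by rewrite mulnBl -mulnA ![_ * k]mulnC -Ez -Ey; lia.
  exists (3 * y ^ 2 - z ^ 2).
  by rewrite mulnBl -mulnA ![_ * k]mulnC -Ez -Ey; lia.
have := not_both_even _ _ co_xw; have := not_both_even _ _ co_yz; move: not_odd.
rewrite !inE => N O1 O /or4P[] /eqP Ek; move: Ez Ey; rewrite Ek;
have := sqr_mod8 x; have := sqr_mod8 w; have := sqr_mod8 y; have := sqr_mod8 z;
move: N O1 O;
case: (odd x); case: (odd y); case: (odd z); case: (odd w) => //= _ _ _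
  [i1 ?] [i2 ?] [i3 ?] [i4 ?]; lia.
Qed.

(** The parametrization of primitive Pythagorean triples, from
    [(f - g) / 2 * ((f + g) / 2) = (e / 2) ^ 2]. *)
Lemma pythagorean (g e f : nat) :
    0 < e -> ~~ odd e -> coprime g e -> g ^ 2 + e ^ 2 = f ^ 2 ->
  exists p q, [/\ e = 2 * (p * q), g + q ^ 2 = p ^ 2, coprime p q
                & odd p (+) odd q].
Proof.
move=> e_gt0 e_even co_ge Ef.
have g_odd : odd g.
  by have := not_both_even _ _ co_ge; rewrite (negPf e_even) orbF.
have f_odd : odd f.
  by have := congr1 odd Ef; rewrite oddD !oddX /= g_odd (negPf e_even) => <-.
have lt_gf : g < f by rewrite -(ltn_exp2r _ _ (isT : 0 < 2)) -Ef; lia.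
have [m Em] : exists m, f = g + 2 * m.
  by exists (f - g)./2; move: lt_gf g_odd f_odd; lia.
have [h Eh] : exists h, e = 2 * h by exists e./2; lia.
have hm : (g + m) * m = h ^ 2 by move: Ef; rewrite Em Eh; lia.
have co_gm : coprime (g + m) m.
  rewrite coprime_sym /coprime gcdnDr -/(coprime m g) coprime_sym.
  apply: (@coprime_dvdr _ (e ^ 2)); last by rewrite coprimeXr.
  by apply/dvdnP; exists (4 * (g + m)); rewrite -mulnA hm Eh; ring.
have [p [q [Ep Eq]]] := coprime_mul_sqrP _ _ _ co_gm hm.
exists p, q; split.
- rewrite Eh; congr (2 * _); apply/eqP.
  by rewrite -(eqn_exp2r _ _ (isT : 0 < 2)) -hm Ep Eq expnMn.
- by rewrite -Ep -Eq.
- by move: co_gm; rewrite Ep Eq coprime_pexpl // coprime_pexpr.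
have := congr1 odd Ep; rewrite Eq oddD !oddX /= g_odd.
by case: (odd p); case: (odd q).
Qed.

(** Infinite descent on [g * e].  Both triples [(g, e, f)] and [(g, 3 * e, d)] are
    primitive once 3 does not divide [g], and their parametrizations
    share the leg [g]. *)
Lemma no_concordant (g e f d : nat) :
    0 < g -> 0 < e -> coprime g e ->
  g ^ 2 + e ^ 2 = f ^ 2 -> g ^ 2 + 9 * e ^ 2 = d ^ 2 -> False.
Proof.
have [n] := ubnP (g * e).
elim: n g e f d => // n IHn g e f d; rewrite ltnS => lt_n g_gt0 e_gt0 co_ge Ef Ed.
(* If g = 3 h then d = 3 d', and (e, h) is a smaller solution. *)
have [/dvdnP[h Eg]|g3] := boolP (3 %| g).
  have h_gt0 : 0 < h by lia.
  have [d' Ed'] : exists d', d = 3 * d'.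
    have : 3 %| d ^ 2.
      by apply/dvdnP; exists (3 * (h ^ 2 + e ^ 2)); rewrite -Ed Eg; lia.
    by rewrite Euclid_dvdX // => /andP[/dvdnP[d' ->] _]; exists d'; rewrite mulnC.
  apply: (IHn e h d' f) => //.
  - by apply: leq_trans lt_n; rewrite Eg; nia.
  - by move: co_ge; rewrite Eg coprimeMl coprime_sym => /andP[].
  - by move: Ed; rewrite Eg Ed'; lia.
  - by move: Ef; rewrite Eg; lia.
have co_g3e : coprime g (3 * e).
  by rewrite coprimeMr co_ge andbT coprime_sym prime_coprime.
have Ed3 : g ^ 2 + (3 * e) ^ 2 = d ^ 2 by rewrite -Ed; lia.
have e3_gt0 : 0 < 3 * e by rewrite muln_gt0.
(* Exactly one of g, e is even, and it is the leg 2 p q of its triple; for g even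
   no solution exists, for e even the descent goes on. *)
have [e_odd|e_even] := boolP (odd e).
  have g_even : ~~ odd g.
    move: Ef e_odd; have := sqr_mod8 g; have := sqr_mod8 e; have := sqr_mod8 f.
    by case: (odd g); case: (odd e); case: (odd f) => // -[i ?] [j ?] [k ?]; lia.
  rewrite coprime_sym in co_ge; rewrite coprime_sym in co_g3e.
  rewrite addnC in Ef; rewrite addnC in Ed3.
  have [p [q [Eg Epq co_pq odd_pq]]] := pythagorean _ _ _ g_gt0 g_even co_ge Ef.
  have [r [s [Eg' Ers co_rs _]]] := pythagorean _ _ _ g_gt0 g_even co_g3e Ed3.
  have pq_rs : p * q = r * s by lia.
  have [p_gt0 q_gt0] : 0 < p /\ 0 < q by apply/andP; rewrite -muln_gt0; lia.
  have [r_gt0 s_gt0] : 0 < r /\ 0 < s by apply/andP; rewrite -muln_gt0; lia.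
  have eq_pqrs : 3 * p ^ 2 + s ^ 2 = r ^ 2 + 3 * q ^ 2 by lia.
  have [x [y [z [w [[Ep Eq Er Es] [_ _ z_gt0 _] co_yz co_xw]]]]] :=
    four_number _ _ _ _ p_gt0 q_gt0 r_gt0 co_pq pq_rs.
  have not_odd : ~~ [&& odd x, odd y, odd z & odd w].
    by apply: odd_addb_factors; rewrite -Ep -Eq.
  apply: (common_factor_3_1 x y z w z_gt0 co_xw co_yz not_odd).
  transitivity (3 * p ^ 2 + s ^ 2); first by rewrite Ep Es; ring.
  by rewrite eq_pqrs Eq Er; ring.
have e3_even : ~~ odd (3 * e) by rewrite oddM.
have [p [q [Ee Epq co_pq odd_pq]]] := pythagorean _ _ _ e_gt0 e_even co_ge Ef.
have [r [s [Ee' Ers co_rs _]]] := pythagorean _ _ _ e3_gt0 e3_even co_g3e Ed3.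
have rs_3pq : r * s = 3 * (p * q) by lia.
have [p_gt0 q_gt0] : 0 < p /\ 0 < q by apply/andP; rewrite -muln_gt0; lia.
have [r_gt0 s_gt0] : 0 < r /\ 0 < s by apply/andP; rewrite -muln_gt0; lia.
have smaller x y z w : p = x * y -> q = z * w -> x * w < n.
  move=> Ep Eq; apply: leq_trans lt_n; rewrite Ee.
  have -> : g * (2 * (p * q)) = (x * w) * (g * (y * z) * 2).
    by rewrite Ep Eq; ring.
  move: p_gt0 q_gt0; rewrite Ep Eq !muln_gt0 => /andP[x0 y0] /andP[z0 w0].
  have gyz_gt0 : 0 < g * (y * z) by rewrite !muln_gt0 g_gt0 y0 z0.
  by rewrite ltn_Pmulr ?muln_gt0 ?w0 ?x0 //; lia.
have eq_pqrs : p ^ 2 + s ^ 2 = r ^ 2 + q ^ 2 by lia.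
have : 3 %| r * s by rewrite rs_3pq dvdn_mulr.
(* The factor 3 belongs to r or to s; accordingly (w, x) or (x, w) is the
   smaller solution. *)
rewrite Euclid_dvdM // => /orP[] /dvdnP[t Et].
  have t_gt0 : 0 < t by lia.
  have pq_ts : p * q = t * s by move: rs_3pq; rewrite Et; lia.
  have [x [y [z [w [[Ep Eq Er Es] [x_gt0 _ z_gt0 w_gt0] co_yz co_xw]]]]] :=
    four_number _ _ _ _ p_gt0 q_gt0 t_gt0 co_pq pq_ts.
  have lt_xw := smaller _ _ _ _ Ep Eq.
  have not_odd : ~~ [&& odd x, odd y, odd z & odd w].
    by apply: odd_addb_factors; rewrite -Ep -Eq.
  have eq_xyzw : y ^ 2 * (x ^ 2 + w ^ 2) = z ^ 2 * (9 * x ^ 2 + w ^ 2).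
    transitivity (p ^ 2 + s ^ 2); first by rewrite Ep Es; ring.
    by rewrite eq_pqrs Et Eq Er; ring.
  have [Ez Ey] := common_factor_1_9 x y z w z_gt0 co_xw co_yz not_odd eq_xyzw.
  apply: (IHn w x z y) => //; try by rewrite addnC.
    by rewrite mulnC.
  by rewrite coprime_sym.
have t_gt0 : 0 < t by lia.
have pq_rt : p * q = r * t by move: rs_3pq; rewrite Et; lia.
have [x [y [z [w [[Ep Eq Er Es] [x_gt0 y_gt0 _ w_gt0] co_yz co_xw]]]]] :=
  four_number _ _ _ _ p_gt0 q_gt0 r_gt0 co_pq pq_rt.
have lt_xw := smaller _ _ _ _ Ep Eq.
have not_odd : ~~ [&& odd w, odd z, odd y & odd x].
  by apply: odd_addb_factors; rewrite [w * z]mulnC [y * x]mulnC -Ep -Eq addbC.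
have eq_xyzw : z ^ 2 * (w ^ 2 + x ^ 2) = y ^ 2 * (9 * w ^ 2 + x ^ 2).
  transitivity (r ^ 2 + q ^ 2); first by rewrite Eq Er; ring.
  by rewrite -eq_pqrs Et Ep Es; ring.
have co_wx : coprime w x by rewrite coprime_sym.
rewrite coprime_sym in co_yz.
have [Ey Ez] := common_factor_1_9 w z y x y_gt0 co_wx co_yz not_odd eq_xyzw.
by apply: (IHn x w y z) => //; rewrite addnC.
Qed.

(** * The curve (d^2 - 9 e^2) (d^2 - 8 e^2) = j^2 *)

(** The difference [e ^ 2] of the two factors is coprime to each of them, so both
    are squares up to sign.  Positive factors contradict [no_concordant]. *)
Lemma coprime_no_square (d e j : nat) : 0 < e -> 0 < j -> coprime d e ->
  ((d%:Z ^+ 2 - 9 * e%:Z ^+ 2) * (d%:Z ^+ 2 - 8 * e%:Z ^+ 2) = j%:Z ^+ 2)%R ->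
  False.
Proof.
move=> e_gt0 j_gt0 co_de Ej.
have co_sqr : coprime (d ^ 2) (e ^ 2) by rewrite coprimeXl ?coprimeXr.
have e2_gt0 : 0 < e ^ 2 by rewrite expn_gt0 e_gt0.
have j2_gt0 : 0 < j ^ 2 by rewrite expn_gt0 j_gt0.
have [/subnKC|lt_d9] := leqP (9 * e ^ 2) (d ^ 2).
  set a := d ^ 2 - _ => Ed.
  have aj : a * (a + e ^ 2) = j ^ 2 by move: Ej Ed; nia.
  have co_a : coprime a (e ^ 2).
    rewrite /coprime -dvdn1 -[X in _ %| X](eqP co_sqr) dvdn_gcd dvdn_gcdr andbT.
    by rewrite -Ed dvdn_add ?dvdn_gcdl // dvdn_mull // dvdn_gcdr.
  have co_aae : coprime a (a + e ^ 2) by rewrite /coprime gcdnDl.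
  have [g [f [Eg Ef]]] := coprime_mul_sqrP _ _ _ co_aae aj.
  apply: (no_concordant g e f d) => //.
  - by rewrite lt0n; apply: contraTneq j2_gt0 => g0; rewrite -aj Eg g0.
  - by move: co_a; rewrite Eg coprime_pexpl // coprime_pexpr.
  - by rewrite -Eg.
  - by rewrite -Ed -Eg addnC.
have [lt_8d|/subnKC] := ltnP (8 * e ^ 2) (d ^ 2).
  by move: Ej lt_8d lt_d9 j2_gt0; nia.
set a := _ - d ^ 2 => Ed.
have aj : a * (a + e ^ 2) = j ^ 2 by move: Ej Ed; nia.
have co_a : coprime a (e ^ 2).
  rewrite /coprime -dvdn1 -[X in _ %| X](eqP co_sqr) dvdn_gcd dvdn_gcdr andbT.
  by rewrite -(dvdn_addl _ (dvdn_gcdl a (e ^ 2))) Ed dvdn_mull // dvdn_gcdr.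
have co_aae : coprime a (a + e ^ 2) by rewrite /coprime gcdnDl.
have [f [g [Ef Eg]]] := coprime_mul_sqrP _ _ _ co_aae aj.
rewrite Ef in Eg Ed; have := not_both_even _ _ co_de; move: Eg Ed.
(* Now d^2 + f^2 = 8 e^2 and d^2 + g^2 = 9 e^2.  The first makes d and f even,
   their halves odd and so d^2 = 4 modulo 8, against the second. *)
have := sqr_mod8 d; have := sqr_mod8 e; have := sqr_mod8 f; have := sqr_mod8 g.
case: (odd d); case: (odd e); case: (odd f); case: (odd g) => //;
 move=> -[i1 ?] [i2 ?] [i3 ?] [i4 ?]; try lia.
move: (sqr_mod8 i2) (sqr_mod8 i4).
by case: (odd i2) => -[? ?]; case: (odd i4) => -[? ?]; lia.
Qed.

Local Open Scope ring_scope.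

Lemma no_square (m D k : int) : D != 0 -> k != 0 ->
  (m ^+ 2 - 9 * D ^+ 2) * (m ^+ 2 - 8 * D ^+ 2) = k ^+ 2 -> False.
Proof.
move=> D0 k0 Ek; set h := gcdn `|m| `|D|.
have h_gt0 : (0 < h)%N by rewrite gcdn_gt0 !absz_gt0 D0 orbT.
have [d Em] : exists d, `|m|%N = (d * h)%N by apply/dvdnP/dvdn_gcdl.
have [e Ee] : exists e, `|D|%N = (e * h)%N by apply/dvdnP/dvdn_gcdr.
have co_de : coprime d e.
  by rewrite /coprime -(eqn_pmul2r h_gt0) muln_gcdl -Em -Ee mul1n.
have m2 : m ^+ 2 = (d%:Z * h%:Z) ^+ 2 by rewrite -PoszM -Em; lia.
have D2 : D ^+ 2 = (e%:Z * h%:Z) ^+ 2 by rewrite -PoszM -Ee; lia.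
set X := (d%:Z ^+ 2 - 9 * e%:Z ^+ 2) * (d%:Z ^+ 2 - 8 * e%:Z ^+ 2).
have EX : k ^+ 2 = X * (h%:Z ^+ 2) ^+ 2 by rewrite -Ek m2 D2 /X; ring.
have /dvdnP[j Ej] : (h ^ 2 %| `|k|)%N.
  rewrite -(@dvdn_pexp2r _ _ 2) //; apply/dvdnP; exists `|X|%N.
  by have := congr1 absz EX; rewrite abszM !abszX.
have k2 : k ^+ 2 = (j%:Z * h%:Z ^+ 2) ^+ 2.
  rewrite (_ : h%:Z ^+ 2 = (h ^ 2)%N%:Z); last by lia.
  by rewrite -PoszM -Ej; clear; lia.
apply: (@coprime_no_square d e j) => //.
- by move: D0; rewrite -absz_gt0 Ee muln_gt0 => /andP[].
- by move: k0; rewrite -absz_gt0 Ej muln_gt0 => /andP[].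
have h0 : (h%:Z ^+ 2) ^+ 2 != 0 by rewrite !expf_eq0 /=; lia.
by apply: (mulIf h0); rewrite -EX k2 exprMn.
Qed.

(** The square root of 2 is irrational, by the parity of 2-adic valuations. *)
Lemma sqr_eq_double_sqr (x y : int) : x ^+ 2 = 2 * y ^+ 2 -> y = 0.
Proof.
move=> xy; apply: contraTeq isT => y0.
have y_gt0 : (0 < `|y|)%N by rewrite absz_gt0.
have nat_xy : (`|x| ^ 2 = 2 * `|y| ^ 2)%N by lia.
have := congr1 (logn 2) nat_xy; rewrite lognM ?expn_gt0 ?y_gt0 // !lognX.
by rewrite (_ : logn 2 2 = 1%N) //; lia.
Qed.

(** * Products of two monic quartics *)

(** Derives an equation from another one up to ring normalization, which disposes
    of the second premise. *)
Lemma eq_of_sub (x y z t : int) : z = t -> x - y = z - t -> x = y.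
Proof. by move=> -> /eqP; rewrite subrr subr_eq0 => /eqP. Qed.

(** The coefficients of t^7, ..., t^0 in
    (t^4 + q3 t^3 + q2 t^2 + q1 t + q0) (t^4 + r3 t^3 + r2 t^2 + r1 t + r0),
    compared with those of P for D = u^2 - a^2 and n = a u. *)
Definition quartic_factors (D n q0 q1 q2 q3 r0 r1 r2 r3 : int) : Prop :=
  [/\ [/\ q3 + r3 = 0,
          q2 + r2 + q3 * r3 = 6 * D,
          q1 + r1 + q3 * r2 + q2 * r3 = 0
        & q0 + r0 + q3 * r1 + q2 * r2 + q1 * r3 = D ^+ 2 - 2 * n ^+ 2],
      q3 * r0 + q2 * r1 + q1 * r2 + q0 * r3 = 0,
      q2 * r0 + q1 * r1 + q0 * r2 = - (6 * D * n ^+ 2),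
      q1 * r0 + q0 * r1 = 0
    & q0 * r0 = n ^+ 4].

(** Write q2 = 3 D - m, r2 = 3 D + m and Y = m^2 - 8 D^2.  The constant terms have
    sum Y - 2 n^2, their difference times m is - 3 D Y, and their product is n^4.
    Hence m^2 (Y - 2 n^2)^2 - (3 D Y)^2 = 4 m^2 n^4.  Since 2 is not a rational
    square, Y is not zero; cancelling it leaves (m^2 - 9 D^2) Y = (2 n m)^2. *)
Lemma no_even_factors (D n q0 q1 q2 q3 r0 r1 r2 r3 : int) :
    D != 0 -> n != 0 -> quartic_factors D n q0 q1 q2 q3 r0 r1 r2 r3 ->
  q1 = 0 -> q3 = 0 -> False.
Proof.
move=> D0 n0 T; have [[t7 t6 t5 t4] t3 t2 t1 t0] := T.
move=> q1_0 q3_0; have r3_0 : r3 = 0 by lia.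
have r1_0 : r1 = 0 by lia.
pose m := 3 * D - q2.
have Eq2 : q2 = 3 * D - m by rewrite /m; ring.
have Er2 : r2 = 3 * D + m by rewrite /m; lia.
pose Y := m ^+ 2 - 8 * D ^+ 2.
have sum_qr : q0 + r0 = Y - 2 * n ^+ 2.
  by apply: (eq_of_sub _ _ _ _ t4); rewrite Eq2 Er2 q3_0 q1_0 /Y; ring.
have dif_qr : m * (q0 - r0) = - 3 * D * Y.
  have : 3 * D * (q0 + r0) + m * (q0 - r0) = - (6 * D * n ^+ 2).
    by rewrite -t2 Eq2 Er2 q1_0; ring.
  by rewrite sum_qr => /eq_of_sub; apply; ring.
have : Y * ((m ^+ 2 - 9 * D ^+ 2) * Y) = Y * (2 * n * m) ^+ 2.
  have : m ^+ 2 * (q0 + r0) ^+ 2 - (m * (q0 - r0)) ^+ 2 = 4 * m ^+ 2 * n ^+ 4.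
    by rewrite -t0; ring.
  by rewrite sum_qr dif_qr => /eq_of_sub; apply; ring.
have Y0 : Y != 0.
  apply/eqP=> Y0; have : m ^+ 2 = 2 * (2 * D) ^+ 2.
    by apply: (eq_of_sub _ _ _ _ Y0); rewrite /Y; ring.
  by move/sqr_eq_double_sqr; lia.
move/(mulfI Y0) => E; apply: (@no_square m D (2 * n * m)) => //.
rewrite !mulf_neq0 //; apply/eqP=> m0; move: E; rewrite /Y m0.
move=> E; have /eqP : 72 * D ^+ 4 = 0 by apply: (eq_of_sub _ _ _ _ E); ring.
by rewrite mulf_eq0 expf_eq0 /= (negPf D0).
Qed.

(** Here R(t) = Q(- t), hence q0 is n^2 or - n^2.  In the first case q1^2 and q3^2
    are n^2 (2 q2 + 6 D) and 2 q2 - 6 D; comparing their product with the square of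
    q1 q3 gives (q2^2 - D^2 - 4 n^2)^2 + 128 (n D)^2 = 0.  In the second case
    q1^2 = - (n q3)^2, so Q and R are even. *)
Lemma no_mirror_factors (D n q0 q1 q2 q3 r0 r1 r2 r3 : int) :
    D != 0 -> n != 0 -> quartic_factors D n q0 q1 q2 q3 r0 r1 r2 r3 ->
  q0 = r0 -> q2 = r2 -> r1 = - q1 -> False.
Proof.
move=> D0 n0 T; have [[t7 t6 t5 t4] t3 t2 t1 t0] := T.
move=> E0 E2 E1.
have E3 : r3 = - q3 by lia.
have sq3 : q3 ^+ 2 = 2 * q2 - 6 * D.
  by apply: (eq_of_sub _ _ _ _ (esym t6)); rewrite -E2 E3; ring.
have /orP[/eqP N0|/eqP N0] : (q0 == n ^+ 2) || (q0 == - n ^+ 2).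
  rewrite -eqf_sqr; apply/eqP; move: t0; rewrite -E0 => t0'.
  by rewrite -exprM -t0'; ring.
- have sq1 : q1 ^+ 2 = n ^+ 2 * (2 * q2 + 6 * D).
    by apply: (eq_of_sub _ _ _ _ (esym t2)); rewrite -E0 -E2 E1 N0; ring.
  have pr : 2 * q1 * q3 = q2 ^+ 2 + 4 * n ^+ 2 - D ^+ 2.
    by apply: (eq_of_sub _ _ _ _ (esym t4)); rewrite -E0 -E2 E1 E3 N0; ring.
  have : (q2 ^+ 2 - D ^+ 2 - 4 * n ^+ 2) ^+ 2 + 128 * (n * D) ^+ 2 = 0.
    have : 4 * q1 ^+ 2 * q3 ^+ 2 = (2 * q1 * q3) ^+ 2 by ring.
    by rewrite sq1 sq3 pr => /esym/eq_of_sub; apply; ring.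
  have nD_ge0 : 0 <= 128 * (n * D) ^+ 2 by rewrite pmulr_rge0 // sqr_ge0.
  move/eqP; rewrite (paddr_eq0 (sqr_ge0 _) nD_ge0) => /andP[_].
  by rewrite mulf_eq0 expf_eq0 mulf_eq0 (negPf n0) (negPf D0).
have sq : (n * q3) ^+ 2 + q1 ^+ 2 = 0.
  rewrite exprMn sq3.
  by apply: (eq_of_sub _ _ _ _ (esym t2)); rewrite -E0 -E2 E1 N0; ring.
move/eqP: sq; rewrite paddr_eq0 ?sqr_ge0 // !expf_eq0 /= mulf_eq0 (negPf n0) /=.
case/andP=> /eqP q3_0 /eqP q1_0.
exact: (no_even_factors _ _ _ _ _ _ _ _ _ _ D0 n0 T).
Qed.

(** If B is not zero, then neither A E + B C = 0 nor the irrationality of the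
    square root of 2 leaves room for anything but C = A and E = - B. *)
Lemma no_quartic_factors (D n q0 q1 q2 q3 r0 r1 r2 r3 : int) :
    D != 0 -> n != 0 -> quartic_factors D n q0 q1 q2 q3 r0 r1 r2 r3 ->
  False.
Proof.
move=> D0 n0 T; have [[t7 t6 t5 t4] t3 t2 t1 t0] := T.
have E3 : r3 = - q3 by lia.
have [q3_0|q3_0] := eqVneq q3 0.
  have E1 : r1 = - q1 by lia.
  have [q1_0|q1_0] := eqVneq q1 0; first
    exact: (no_even_factors _ _ _ _ _ _ _ _ _ _ D0 n0 T).
  apply: (no_mirror_factors _ _ _ _ _ _ _ _ _ _ D0 n0 T) => //.
    by apply/esym/(mulfI q1_0)/(eq_of_sub _ _ _ _ t1); rewrite E1; ring.
  by apply/esym/(mulfI q1_0)/(eq_of_sub _ _ _ _ t3); rewrite E1 E3 q3_0; ring.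
(* A E + B C = 0 at the root s = - q1 / q3 of B, cleared of denominators: A or E
   vanishes there. *)
have /eqP : (q1 ^+ 2 - q2 * q1 * q3 + q0 * q3 ^+ 2) * (q1 + r1) = 0.
  transitivity ((q1 + r1 + q3 * r2 + q2 * r3) * q1 ^+ 2
    - (q3 * r0 + q2 * r1 + q1 * r2 + q0 * r3) * q1 * q3
    + (q1 * r0 + q0 * r1) * q3 ^+ 2); last by rewrite t5 t3 t1; ring.
  by rewrite E3; ring.
rewrite mulf_eq0 => /orP[] /eqP root.
  (* If A vanishes there, so does P = A C + s B E; this is that equation. *)
  have : (q1 ^+ 2 - 3 * D * q1 * q3 - n ^+ 2 * q3 ^+ 2) ^+ 2
         = 2 * (2 * D * q1 * q3) ^+ 2.
    apply/eqP; rewrite -subr_eq0; apply/eqP.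
    transitivity (q1 ^+ 4 - 6 * D * q1 ^+ 3 * q3
      + (D ^+ 2 - 2 * n ^+ 2) * q1 ^+ 2 * q3 ^+ 2
      - (- (6 * D * n ^+ 2)) * q1 * q3 ^+ 3 + n ^+ 4 * q3 ^+ 4); first by ring.
    rewrite -t2 -t4 -t6 -t0 E3.
    transitivity ((q1 ^+ 2 - q2 * q1 * q3 + q0 * q3 ^+ 2) *
      (q1 ^+ 2 - r2 * q1 * q3 + r0 * q3 ^+ 2)); first by ring.
    by rewrite root mul0r.
  move/sqr_eq_double_sqr/eqP; rewrite !mulf_eq0 (negPf D0) (negPf q3_0) /= orbF.
  move/eqP=> q1_0; move: t0 root; rewrite q1_0 => t0' /eqP.
  rewrite mulr0 mul0r subr0 expr0n add0r mulf_eq0 expf_eq0 /= (negPf q3_0) orbF.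
  move/eqP=> q0_0; move: t0'; rewrite q0_0 mul0r => /esym/eqP.
  by rewrite expf_eq0 (negPf n0).
have E1 : r1 = - q1 by lia.
have E2 : q2 = r2.
  by apply/esym/(mulfI q3_0)/(eq_of_sub _ _ _ _ t5); rewrite E1 E3; ring.
apply: (no_mirror_factors _ _ _ _ _ _ _ _ _ _ D0 n0 T) => //.
by apply/esym/(mulfI q3_0)/(eq_of_sub _ _ _ _ t3); rewrite E1 E2 E3; ring.
Qed.

Lemma coef_P (a u i : nat) :
  (P a u)`_i = nth 0 [:: a%:Z ^+ 4 * u%:Z ^+ 4; 0;
    - (6 * Delta a u * a%:Z ^+ 2 * u%:Z ^+ 2); 0;
    Delta a u ^+ 2 - 2 * a%:Z ^+ 2 * u%:Z ^+ 2; 0; 6 * Delta a u; 0; 1] i.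
Proof.
rewrite /P !coefE.
by do 9 (case: i => [|i] /=; first by ring); rewrite nth_nil; ring.
Qed.

Lemma coef_monic_quartic (Q : {poly int}) : Q \is monic -> size Q = 5%N ->
  Q`_4 = 1 /\ forall k, (4 < k)%N -> Q`_k = 0.
Proof.
move=> mQ sQ; split; first by have /monicP := mQ; rewrite lead_coefE sQ.
by move=> k k_gt4; rewrite nth_default ?sQ.
Qed.

Theorem theorem1 (a u : nat) (a_gt0 : (0 < a)%N) (u_gt0 : (0 < u)%N)
    (co_au : coprime a u) (neq_au : a <> u) :
  ~ (exists Q R : {poly int},
       [/\ Q \is monic, R \is monic, size Q = 5%N, size R = 5%N
         & P a u = Q * R]).
Proof.
case=> Q [R [mQ mR sQ sR EP]].
have [Q4 Q_high] := coef_monic_quartic Q mQ sQ.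
have [R4 R_high] := coef_monic_quartic R mR sR.
have coefQR i : \sum_(j < i.+1) Q`_j * R`_(i - j) = (P a u)`_i.
  by rewrite EP coefM.
have D0 : Delta a u != 0 by rewrite subr_eq0 eqf_sqr; lia.
pose high := (Q_high 5%N isT, Q_high 6%N isT, Q_high 7%N isT,
  R_high 5%N isT, R_high 6%N isT, R_high 7%N isT, Q4, R4).
have n0 : a%:Z * u%:Z != 0 by rewrite mulf_neq0 //; lia.
apply: (no_quartic_factors _ _ Q`_0 Q`_1 Q`_2 Q`_3 R`_0 R`_1 R`_2 R`_3 D0 n0).
split; first split.
all: [> apply: (eq_of_sub _ _ _ _ (coefQR 7%N))
      | apply: (eq_of_sub _ _ _ _ (coefQR 6%N))
      | apply: (eq_of_sub _ _ _ _ (coefQR 5%N))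
      | apply: (eq_of_sub _ _ _ _ (coefQR 4%N))
      | apply: (eq_of_sub _ _ _ _ (coefQR 3%N))
      | apply: (eq_of_sub _ _ _ _ (coefQR 2%N))
      | apply: (eq_of_sub _ _ _ _ (coefQR 1%N))
      | apply: (eq_of_sub _ _ _ _ (coefQR 0%N)) ].
all: by rewrite coef_P !big_ord_recr big_ord0 /= ?(subSS, subn0) ?high; ring.
Qed.
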